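(* Consider the clipped GLM with sparsity prior described in the context. Let $a_n>0$ and let $\lambda_n$ satisfy Assumption $\mathcal{L}_0$, i.e. $\mathcal{M}(A,X)/d_n\le \lambda_n\le \mathcal{M}(A,X)\sqrt{\log d_n}$. Let $n,d_n\to\infty$ with $d_n>n$, let $\{b_n\}$ be a positive sequence with $b_n=o(n/\log d_n)$, and consider $n$ large enough that $b_n\log d_n<n$. Let the true parameter $\beta^*$ belong to $\mathcal{B}_{2,n}=\{\beta\in\mathbb{R}^{d_n}:0<|\mathrm{supp}(\beta)|\le b_n\}$. Then, with probability at least $1-(s_n^*\log d_n)^{-1}$ with respect to the data generating distribution (with parameter $\beta^*$), for all sufficiently large $n$ the marginal likelihood satisfies $$\int \exp\big(L_n(\eta,\eta^* )\big)\,\Pi_n(\beta)\,d\beta \;\gtrsim\; C_n\, d_n^{-(a_n+6)s_n^*}\exp(-\lambda_n\|\beta^*\|_1),$$ where $\gtrsim$ means $\ge$ up to a positive absolute constant.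
   Context: Exponential family: $f(y\mid\theta)=h(y)\exp[\theta T(y)-A(\theta)]$, $y\in\mathcal{Y}\subset\mathbb{R}$, with convex log-partition function $A$ such that $A''$ exists everywhere on the domain of $A$ and, for every $b\in(0,\infty]$, $\mathcal{I}_A(b):=\{t\in\mathbb{R}:0\le A''(t)\le b\}$ is an interval. Clipping function: there is a constant $\mathcal{M}_0(A)>0$ such that $\eta:\mathbb{R}\to\mathcal{I}_A(\mathcal{M}_0^2(A)/2)$ is Lipschitz and injective. Data: design matrix $X\in\mathbb{R}^{n\times d_n}$ with rows $x_i^{\mathrm T}$; for $\beta\in\mathbb{R}^{d_n}$ put $\eta_i=\eta(x_i^{\mathrm T}\beta)$, and for the true parameter $\beta^*$ put $\eta_i^*=\eta(x_i^{\mathrm T}\beta^* )$. Observations $y_1,\dots,y_n$ are independent with densities $h(y_i)\exp(T_i\eta_i^*-A(\eta_i^* ))$, $T_i=T(y_i)$. Define $\mathcal{D}_n(\eta^*\|\eta)=\sum_{i=1}^n[A(\eta_i)-A(\eta_i^* )-(\eta_i-\eta_i^* )A'(\eta_i^* )]$, $Z_n(\eta,\eta^* )=\sum_{i=1}^n (T_i-\mathbb{E}T_i)(\eta_i-\eta_i^* )$, and $L_n(\eta,\eta^* )=Z_n(\eta,\eta^* )-\mathcal{D}_n(\eta^*\|\eta)$. $S^*=\mathrm{supp}(\beta^* )$ (set of nonzero coordinates) and $s_n^*=|S^*|$. Prior: for $S\subset\{1,\dots,d_n\}$, $\beta_S$ denotes $\beta$ with coordinates in $S^c$ set to zero, and $$\Pi_n(S,\beta)=C_n\binom{d_n}{|S|}^{-1}\Big(\frac{\lambda_n}{2d_n^{a_n}}\Big)^{|S|}\exp(-\lambda_n\|\beta_S\|_1)\,\delta_0(\beta_{S^c}),$$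 with hyperparameters $a_n>0,\lambda_n>0$, $C_n$ the normalizing constant of the model-size weights $\omega_n(s)=C_nd_n^{-a_ns}$, $s=0,\dots,d_n$, and $\Pi_n(\beta)=\sum_S\Pi_n(S,\beta)$. Constants: $\|X\|_{(\infty,\infty)}:=\max\{X_{i,j}:1\le i\le n,1\le j\le d_n\}$, $\mathcal{M}_1(A):=(1\wedge\mathcal{M}_0^{-1}(A))^{-1}$, $\mathcal{M}(A,X):=\|X\|_{(\infty,\infty)}\mathcal{M}_1(A)$.
   Formalization: The norm ‖X‖_(∞,∞) is taken as max|X_{i,j}| (absolute values added), which changes the range of λ_n in Assumption L_0; with max X_{i,j} read literally the claim fails for designs with large negative and only tiny positive entries. *)

(* Defs.v *)
From HB Require Import structures.
From mathcomp Require Import all_boot all_order all_algebra.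
From mathcomp Require Import all_classical all_reals all_analysis.
Set Implicit Arguments. Unset Strict Implicit. Unset Printing Implicit Defensive.
Import Order.TTheory GRing.Theory Num.Theory.
Import numFieldNormedType.Exports.
Local Open Scope classical_set_scope.
Local Open Scope ring_scope.

Section GLMDefs.
Variable R : realType.

Definition A2 (A : R -> R) : R -> R := derive1 (derive1 A).

Definition IA (Theta : set R) (A : R -> R) (b : R) : set R :=
  [set t | Theta t /\ 0 <= A2 A t <= b].
Definition IA_inf (Theta : set R) (A : R -> R) : set R :=
  [set t | Theta t /\ 0 <= A2 A t].

Definition lin_pred (n d : nat) (X : 'M[R]_(n, d)) (beta : 'I_d -> R)
  (i : 'I_n) : R := \sum_(j < d) X i j * beta j.

Definition Dn (n d : nat) (A : R -> R) (eta : R -> R) (X : 'M[R]_(n, d))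
  (beta beta_star : 'I_d -> R) : R :=
  \sum_(i < n)
    (A (eta (lin_pred X beta i)) - A (eta (lin_pred X beta_star i))
     - (eta (lin_pred X beta i) - eta (lin_pred X beta_star i))
       * derive1 A (eta (lin_pred X beta_star i))).

(* Z_n(eta, eta_star) with Tobs i = T_i and ET i = E T_i *)
Definition Zn (n d : nat) (Tobs ET : 'I_n -> R) (eta : R -> R)
  (X : 'M[R]_(n, d)) (beta beta_star : 'I_d -> R) : R :=
  \sum_(i < n) (Tobs i - ET i)
               * (eta (lin_pred X beta i) - eta (lin_pred X beta_star i)).

Definition Ln (n d : nat) (A : R -> R) (Tobs ET : 'I_n -> R) (eta : R -> R)
  (X : 'M[R]_(n, d)) (beta beta_star : 'I_d -> R) : R :=
  Zn Tobs ET eta X beta beta_star - Dn A eta X beta beta_star.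

Definition Xnorm (n d : nat) (X : 'M[R]_(n, d)) : R :=
  \big[Num.max/0]_(i < n) \big[Num.max/0]_(j < d) `|X i j|.

Definition M1 (M0 : R) : R := (Num.min 1 M0^-1)^-1.
Definition MAX (M0 : R) (n d : nat) (X : 'M[R]_(n, d)) : R := Xnorm X * M1 M0.

(* normalizing constant C_n of omega_n(s) = C_n d^{-a s}, s = 0..d *)
Definition Cn (d : nat) (a : R) : R :=
  (\sum_(s < d.+1) (d%:R) `^ (- (a * s%:R)))^-1.

Definition supp_size (d : nat) (beta : 'I_d -> R) : nat := #|[set j | beta j != 0]|.
Definition l1 (d : nat) (beta : 'I_d -> R) : R := \sum_(j < d) `|beta j|.

Definition upd (d : nat) (beta : 'I_d -> R) (j : 'I_d) (x : R) : 'I_d -> R :=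
  fun k => if k == j then x else beta k.

Fixpoint iterint (d : nat) (js : seq 'I_d) (F : ('I_d -> R) -> \bar R)
  (beta : 'I_d -> R) {struct js} : \bar R :=
  match js with
  | [::] => F beta
  | j :: js' => (\int[@lebesgue_measure R]_x iterint js' F (upd beta j x))%E
  end.

Definition int_RS (d : nat) (S : {set 'I_d}) (F : ('I_d -> R) -> \bar R) : \bar R :=
  iterint (enum S) F (fun=> 0).

Definition prior_coef (d : nat) (a lam : R) (S : {set 'I_d}) : R :=
  Cn d a * ('C(d, #|S|)%:R)^-1 * (lam / (2 * (d%:R `^ a))) ^+ #|S|.

(* int g(beta) Pi_n(beta) d beta, for g >= 0 *)
Definition prior_integral (d : nat) (a lam : R) (g : ('I_d -> R) -> R) : \bar R :=
  (\sum_(S : {set 'I_d})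
     (prior_coef a lam S)%:E
     * int_RS S (fun beta => (g beta * expR (- lam * l1 beta))%:E))%E.

Definition mutually_indep (dO : measure_display) (Om : measurableType dO)
  (P : probability Om R) (n : nat) (Y : 'I_n -> Om -> R) : Prop :=
  forall B : 'I_n -> set R, (forall i, measurable (B i)) ->
    P [set w | forall i, B i (Y i w)] =
    (\prod_(i < n) fine (P (Y i @^-1` B i)))%:E.

End GLMDefs.

(* Main.v *)
Require Import Defs.
From HB Require Import structures.
From mathcomp Require Import all_boot all_order all_algebra.
From mathcomp Require Import all_classical all_reals all_analysis.
From mathcomp Require Import measurable_realfun ring lra.
Import Order.TTheory GRing.Theory Num.Theory.
Import numFieldNormedType.Exports.
Local Open Scope classical_set_scope.
Local Open Scope ring_scope.

(** The slab for [S = supp(beta_star)] alone suffices, restricted to a tiny cube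
    around [beta_star] of l1-radius [r ~ 1 / (|X| n^2)].  There
    [L_n >= - K |X| r W - O(n (K |X| r)^2)] with [W = sum_i |T_i - E T_i|], so
    [L_n] is bounded below by a constant as soon as [W = O(n^2)].  Comparing the
    moment generating function of [T_i] at [+t] and [-t] with a second order
    expansion of [A] bounds [E |T_i - E T_i|] uniformly; Markov's inequality then
    gives [W <= C n s log d <= C n^2] outside an event of probability
    [1 / (s log d)].  The price of the small cube and of the lower bound on
    [lambda_n] is polynomial: each active coordinate costs at most [d^-5], and
    [binom(d, s)^-1 >= d^-s]. *)

(** * Lower bounds for integrals, and change of variables through a density *)

Section Measure.
Context {R : realType}.
Import HBNNSimple.

(* No measurability of [f] is required: the integral of a nonnegative function
   is a supremum over the simple functions below it. *)
Lemma le_integral_cst_on d (T : measurableType d)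
    (mu : {measure set T -> \bar R}) (D : set T) (f : T -> \bar R) (c : R) :
  0 <= c -> measurable D -> (forall x, 0 <= f x)%E ->
  (forall x, D x -> c%:E <= f x)%E ->
  (c%:E * mu D <= \int[mu]_x f x)%E.
Proof.
move=> c0 mD f0 fc; pose g := scale_nnsfun (indic_nnsfun R mD) c0.
have gE x : g x = c * \1_D x by [].
have <- : (\int[mu]_x (g x)%:E)%E = (c%:E * mu D)%E.
  under eq_integral do rewrite gE EFinM.
  rewrite ge0_integralZl//=; last first.
    by apply/measurable_EFinP; exact: measurable_indic.
  by rewrite integral_indic//= setIT.
rewrite integral_nnsfun// patch_setT ge0_integralTE//.
apply: ereal_sup_ubound => /=; exists g => // x.
rewrite gE indicE; case: (boolP (x \in _)) => [|_]; last by rewrite mulr0.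
by rewrite inE mulr1 => /fc.
Qed.

Lemma le_integral_itv_cst (f : R -> \bar R) (c a b : R) :
  0 <= c -> a <= b -> (forall x, 0 <= f x)%E ->
  (forall x, a <= x <= b -> (c%:E <= f x)%E) ->
  ((c * (b - a))%:E <= \int[@lebesgue_measure R]_x f x)%E.
Proof.
move=> c0 ab f0 fc.
have mE : @lebesgue_measure R `[a, b]%classic = (b - a)%:E.
  rewrite lebesgue_measure_itv/= lte_fin.
  have [|ba] := ltP a b; first by rewrite -EFinB.
  by rewrite (@le_anti _ _ a b) ?ab ?ba// subrr.
by rewrite EFinM -mE; apply: le_integral_cst_on.
Qed.

(** The law of [Y] is given only through probabilities of measurable sets. Increasing simple
    functions approximate [g], monotone convergence applies on both sides, and on each level set the
    identity is the hypothesis itself. *)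
Lemma ge0_integral_density d (Om : measurableType d)
    (P : {measure set Om -> \bar R}) (mu : {measure set R -> \bar R})
    (Y : Om -> R) (f g : R -> R) :
  measurable_fun setT Y -> measurable_fun setT f -> measurable_fun setT g ->
  (forall y, 0 <= f y) -> (forall y, 0 <= g y) ->
  (forall B, measurable B ->
     P (Y @^-1` B) = (\int[mu]_(y in B) (f y)%:E)%E) ->
  (\int[P]_w (g (Y w))%:E = \int[mu]_y (f y * g y)%:E)%E.
Proof.
move=> mY mf mg f0 g0 PY.
have mgE : measurable_fun setT (EFin \o g) by exact/measurable_EFinP.
pose h := nnsfun_approx measurableT mgE.
have h0 n y : 0 <= h n y by [].
have mh n : measurable_fun setT (h n) by [].
have hg y : (EFin \o h ^~ y) n @[n --> \oo] --> (g y)%:E.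
  by apply: (cvg_nnsfun_approx _ mgE) => // x _; rewrite /= lee_fin.
have hnd y : {homo (fun n => h n y) : m n / (m <= n)%N >-> m <= n}.
  by move=> m n mn; exact/lefP/nd_nnsfun_approx.
have -> : (\int[P]_w (g (Y w))%:E = limn (fun n => \int[P]_w (h n (Y w))%:E))%E.
  under eq_integral do rewrite -(cvg_lim _ (hg _))//.
  apply: monotone_convergence => //.
  - by move=> n; apply/measurable_EFinP; apply: measurableT_comp.
  - by move=> n x _; rewrite lee_fin.
  - by move=> x _ m n mn; rewrite /= lee_fin hnd.
have -> : (\int[mu]_y (f y * g y)%:E = limn (fun n => \int[mu]_y (f y * h n y)%:E))%E.
  under eq_integral => y _.
    rewrite (_ : (f y * g y)%:E = limn (fun n => (f y * h n y)%:E)); last first.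
      apply/esym/cvg_lim => //; under eq_fun do rewrite EFinM.
      by rewrite EFinM; apply: cvgeZl => //; exact: hg.
    over.
  apply: monotone_convergence => //.
  - by move=> n; apply/measurable_EFinP; apply: measurable_funM.
  - by move=> n x _; rewrite lee_fin mulr_ge0.
  - by move=> x _ m n mn; rewrite /= lee_fin ler_wpM2l// hnd.
congr (limn _); apply/funext => n.
(* The simple function is split along its level sets, so that both integrals become finite sums
   compared term by term. *)
have hE y : (h n y)%:E = (\sum_(r \in range (h n)) (r * \1_(h n @^-1` [set r]) y)%:E)%E.
  by rewrite fimfunE -fsumEFin.
have m1 r : measurable_fun setT (fun y => r * \1_(h n @^-1` [set r]) y : R).
  by apply: measurable_funM => //; exact: measurable_indic.
under eq_integral do rewrite hE.
rewrite ge0_integral_fsum//; last 2 first.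
- by move=> r; apply/measurable_EFinP; apply: measurableT_comp (m1 r) mY.
- by move=> r y _; exact: nnfun_muleindic_ge0.
have fhE y : (f y * h n y)%:E = (\sum_(r \in range (h n))
    (f y)%:E * (r * \1_(h n @^-1` [set r]) y)%:E)%E.
  rewrite EFinM hE ge0_mule_fsumr// => r; exact: nnfun_muleindic_ge0.
under [RHS]eq_integral do rewrite fhE.
rewrite ge0_integral_fsum//; last 2 first.
- by move=> r; apply: emeasurable_funM; apply/measurable_EFinP.
- by move=> r y _; rewrite mule_ge0 ?lee_fin//; exact: nnfun_muleindic_ge0.
apply: eq_fsbigr => r; rewrite inE => -[t _ <-].
set B := h n @^-1` _.
have mB : measurable B by exact: measurable_sfunP.
under eq_integral do rewrite EFinM.
rewrite ge0_integralZl//; last 2 first.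
- apply/measurable_EFinP; apply: measurableT_comp mY; exact: measurable_indic.
- by rewrite lee_fin.
transitivity ((h n t)%:E * P (Y @^-1` B))%E.
  congr (_ * _)%E; rewrite -[X in P X]setIT -(@integral_indic _ _ _ P setT)//.
  by rewrite -[X in measurable X]setTI; exact: mY.
rewrite PY//.
under [RHS]eq_integral do rewrite muleC EFinM -muleA.
rewrite ge0_integralZl//; last 3 first.
- by apply/emeasurable_funM; apply/measurable_EFinP => //; exact: measurable_indic.
- by move=> y _; rewrite -EFinM lee_fin mulr_ge0.
- by rewrite lee_fin.
congr (_ * _)%E; rewrite [LHS]integral_mkcond; apply: eq_integral => y _.
by rewrite epatch_indic muleC.
Qed.

End Measure.

(** * Taylor remainders and absolute moments from exponential moments *)

Section Moments.
Context {R : realType}.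

(** Stated without ordering [x] and [y], and with [c] no farther from [x] than [y] is, so that it
    can be iterated from the same base point. *)
Lemma MVT_is_interval (I : set R) (f : R -> R) (x y : R) :
  is_interval I -> (forall z, I z -> derivable f z 1) -> I x -> I y ->
  exists c, [/\ I c, `|c - x| <= `|y - x| & f y - f x = derive1 f c * (y - x)].
Proof.
move=> itvI df.
have mvt u v : u <= v -> I u -> I v ->
    exists c, [/\ I c, u <= c <= v & f v - f u = derive1 f c * (v - u)].
  move=> uv Iu Iv.
  have uvI z : z \in `[u, v] -> I z by rewrite in_itv; exact: itvI.
  have [||c cuv ->] := @MVT_segment R f (derive1 f) u v uv.
  - move=> z zuv; have /df dz : I z by apply: uvI; exact: subset_itv_oo_cc zuv.
    by rewrite derive1E; exact/derivableP.
  - by apply: derivable_within_continuous => z /uvI /df.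
  by exists c; split => //; exact: uvI.
move=> Ix Iy; have [xy|/ltW yx] := leP x y.
- have [c [Ic /andP[xc cy] e]] := mvt _ _ xy Ix Iy; exists c; split => //.
  by rewrite !ger0_norm ?subr_ge0// lerD2r.
- have [c [Ic /andP[xc cy] e]] := mvt _ _ yx Iy Ix; exists c; split => //.
  + by rewrite !ler0_norm ?subr_le0// lerN2 lerD2r.
  + by rewrite -opprB e -mulrN opprB.
Qed.

(** Two mean value steps turn the remainder into [A''(e) (c - x) (y - x)] with [c] between [x] and
    [y]; this gives the constant [B], which is enough here, instead of the sharp [B / 2]. *)
Lemma taylor1_le (I : set R) (A : R -> R) (B x y : R) : is_interval I ->
  (forall z, I z -> [/\ derivable A z 1, derivable (derive1 A) z 1 &
                        `|derive1 (derive1 A) z| <= B]) ->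
  I x -> I y ->
  `|A y - A x - (y - x) * derive1 A x| <= B * (y - x) ^+ 2.
Proof.
move=> itvI AI Ix Iy.
have [z /AI[]//|c [Ic cx ->]] := @MVT_is_interval I A x y itvI _ Ix Iy.
have [z /AI[]//|e [Ie _ ce]] := @MVT_is_interval I (derive1 A) x c itvI _ Ix Ic.
rewrite mulrC -mulrBr ce !normrM -real_normK ?num_real// mulrCA expr2.
have [_ _ Be] := AI _ Ie.
by rewrite ler_pM ?mulr_ge0// ler_wpM2l.
Qed.

(** With [p = exp (x / 2)] and [q = exp (- x / 2)], the right side is [(p - q)^2 + 2], and
    [p - q >= x / 2] for [x >= 0]; both sides are even. *)
Lemma sqr_le_cosh (x : R) : 2 + x ^+ 2 / 4 <= expR x + expR (- x).
Proof.
wlog x0 : x / 0 <= x => [hw|].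
  have [/hw//|/ltW x0] := leP 0 x.
  by have := hw (- x); rewrite oppr_ge0 sqrrN opprK [expR _ + _]addrC; apply.
have e1 : 1 + x / 2 <= expR (x / 2) by exact: expR_ge1Dx.
have e2 : expR (- (x / 2)) <= 1 by rewrite -expR0 ler_expR oppr_le0 divr_ge0.
have ee : expR (x / 2) * expR (- (x / 2)) = 1 by rewrite -expRD subrr expR0.
have -> : expR x = expR (x / 2) ^+ 2 by rewrite expr2 -expRD -splitr.
have -> : expR (- x) = expR (- (x / 2)) ^+ 2.
  by rewrite expr2 -expRD -opprD -splitr.
set p := expR _ in e1 ee *; set q := expR _ in e2 ee *.
have : (x / 2) ^+ 2 <= (p - q) ^+ 2.
  by rewrite lerXn2r ?nnegrE; lra.
rewrite sqrrB; lra.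
Qed.

Lemma expR_le1D2x (x : R) : 0 <= x <= 1 / 2 -> expR x <= 1 + 2 * x.
Proof.
move=> /andP[x0 x1]; have := expR_ge1Dx (- x); rewrite expRN => h.
have := expR_gt0 x; set e := expR x in h * => e0.
have : (1 - x) * e <= 1 by rewrite -ler_pdivlMr// mul1r.
nra.
Qed.

(** Adding the exponential moments at [t] and [- t] gives [2 + (t^2 / 4) E (X - m)^2 <= 2 exp (B
    t^2) <= 2 + 4 B t^2]. Hence the second moment about [m] is at most [16 B], whatever the size of
    [t]. *)
Lemma subgaussian_dev_le d (Om : measurableType d) (P : probability Om R)
    (X : Om -> R) (m B t : R) :
  measurable_fun setT X -> 0 <= B -> 0 < t -> B * t ^+ 2 <= 1 / 2 ->
  (\int[P]_w (expR (t * (X w - m)))%:E <= (expR (B * t ^+ 2))%:E)%E ->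
  (\int[P]_w (expR (- t * (X w - m)))%:E <= (expR (B * t ^+ 2))%:E)%E ->
  (\int[P]_w `|X w - m|%:E <= (1 + 16 * B)%:E)%E.
Proof.
move=> mX B0 t0 Bt Ep En.
have mXm : measurable_fun setT (fun w => X w - m) by apply: measurable_funB.
have mexp s : measurable_fun setT (fun w => (expR (s * (X w - m)))%:E).
  by apply/measurable_EFinP; apply: measurableT_comp => //; exact: measurable_funM.
have msq : measurable_fun setT (fun w => ((X w - m) ^+ 2)%:E).
  by apply/measurable_EFinP; exact: measurable_funX.
have k0 : 0 <= t ^+ 2 / 4 by rewrite divr_ge0// sqr_ge0.
have sq : (\int[P]_w ((X w - m) ^+ 2)%:E <= (16 * B)%:E)%E.
  have le1 : (2%:E + (t ^+ 2 / 4)%:E * \int[P]_w ((X w - m) ^+ 2)%:E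
      <= 2%:E + (4 * (B * t ^+ 2))%:E)%E.
    apply: (@le_trans _ _ ((expR (B * t ^+ 2))%:E + (expR (B * t ^+ 2))%:E)%E).
      apply: le_trans (leeD Ep En).
      rewrite -ge0_integralD//=.
      rewrite -ge0_integralZl//; last by move=> w _; rewrite lee_fin sqr_ge0.
      rewrite -[X in (X + _)%E]mule1 -(@probability_setT _ _ _ P).
      rewrite -(@integral_cst _ _ _ P)// -ge0_integralD//=; last 2 first.
      - by move=> w _; rewrite -EFinM lee_fin mulr_ge0// sqr_ge0.
      - exact: measurable_funeM.
      apply: ge0_le_integral => //=.
      - by move=> w _; rewrite -EFinM lee_fin addr_ge0// mulr_ge0// sqr_ge0.
      - by apply: emeasurable_funD => //; exact: measurable_funeM.
      - by apply: emeasurable_funD.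
      - move=> w _; rewrite -EFinM -!EFinD lee_fin mulNr.
        by apply: le_trans (sqr_le_cosh _); rewrite exprMn mulrAC.
    have := @expR_le1D2x (B * t ^+ 2).
    rewrite mulr_ge0 ?sqr_ge0// Bt => /(_ isT); rewrite -!EFinD lee_fin; lra.
  move: le1; rewrite leeD2lE// -lee_pdivlMl ?divr_gt0 ?exprn_gt0//.
  move/le_trans; apply; rewrite -EFinM lee_fin.
  suff -> : (t ^+ 2 / 4)^-1 * (4 * (B * t ^+ 2)) = 16 * B by [].
  by field; rewrite lt0r_neq0.
(* The first absolute moment follows from [z <= 1 + z^2]. *)
apply: (@le_trans _ _ (\int[P]_w (1%:E + ((X w - m) ^+ 2)%:E))%E).
  apply: ge0_le_integral => //=.
  - by apply/measurable_EFinP; exact: measurableT_comp.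
  - exact: emeasurable_funD.
  - move=> w _; rewrite -EFinD lee_fin -real_normK ?num_real//.
    have := normr_ge0 (X w - m); set z := `|_|; nra.
rewrite ge0_integralD//; last by move=> w _; rewrite lee_fin sqr_ge0.
rewrite integral_cst// [X in (_ * X)%E]probability_setT mule1 EFinD; exact: leeD.
Qed.

(** Recentring from [m] to the mean only doubles the bound, since the mean is itself within
    [E |X - m|] of [m]. *)
Lemma mean_abs_dev_le d (Om : measurableType d) (P : probability Om R)
    (X : Om -> R) (m C : R) :
  measurable_fun setT X ->
  (\int[P]_w `|X w - m|%:E <= C%:E)%E ->
  (\int[P]_w `|X w - fine 'E_P[X]|%:E <= (C + C)%:E)%E.
Proof.
move=> mX XmC.
have mXm : measurable_fun setT (fun w => X w - m) by apply: measurable_funB.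
have iXm : P.-integrable setT (EFin \o (fun w => X w - m)).
  apply/integrableP; split; first exact/measurable_EFinP.
  by under eq_integral do rewrite /=; apply: le_lt_trans XmC _; rewrite ltry.
have im : P.-integrable setT (EFin \o cst m).
  by apply: finite_measure_integrable_cst.
have EX : ('E_P[X] = \int[P]_w (X w - m)%:E + m%:E)%E.
  rewrite unlock; transitivity (\int[P]_w ((X w - m)%:E + (cst m w)%:E))%E.
    by apply: eq_integral => w _; rewrite -EFinD /= subrK.
  rewrite integralD_EFin//= integral_cst//; congr (_ + _)%E.
  by rewrite [X in (_ * X)%E]probability_setT mule1.
have fin : (\int[P]_w (X w - m)%:E)%E \is a fin_num by exact: integrable_fin_num.
have Em : `|m - fine 'E_P[X]| <= C.
  rewrite distrC EX fineD//= addrK -lee_fin -abse_EFin fineK//.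
  apply: le_trans XmC; apply: le_trans (le_abse_integral _ _ _) _ => //.
  exact/measurable_EFinP.
apply: (@le_trans _ _ (\int[P]_w (`|X w - m|%:E + (cst C w)%:E))%E).
  apply: ge0_le_integral => //=.
  - apply/measurable_EFinP; apply: measurableT_comp => //.
    exact: measurable_funB.
  - by apply: emeasurable_funD => //; apply/measurable_EFinP; exact: measurableT_comp.
  - move=> w _; rewrite -EFinD lee_fin.
    apply: (le_trans (ler_distD m _ _)); exact: lerD.
rewrite ge0_integralD//=; last 2 first.
- by apply/measurable_EFinP; exact: measurableT_comp.
- by move=> w _; rewrite lee_fin; exact: le_trans Em.
rewrite integral_cst// [X in (_ * X)%E]probability_setT mule1 EFinD; exact: leeD.
Qed.

End Moments.

(** * Prior mass of a small cube, and a pathwise bound on the log-likelihood ratio *)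

Section Prior.
Context {R : realType}.

Lemma iterint_ge0 d (js : seq 'I_d) (F : ('I_d -> R) -> \bar R) b :
  (forall b', 0 <= F b')%E -> (0 <= iterint js F b)%E.
Proof.
by move=> F0; elim: js b => [//|j js IH] b /=; apply: integral_ge0 => x _.
Qed.

(** Each one-dimensional integral is restricted to the interval of half-length [rho] around [b0 j].
    The point [b] carries the coordinates already fixed by the outer integrals, while [b0] stays the
    centre of the cube. *)
Lemma le_iterint d (js : seq 'I_d) (F : ('I_d -> R) -> \bar R)
    (b0 b : 'I_d -> R) (k rho : R) :
  uniq js -> 0 <= k -> 0 <= rho -> (forall b', 0 <= F b')%E ->
  (forall b', (forall i, i \notin js -> b' i = b i) ->
              (forall i, i \in js -> `|b' i - b0 i| <= rho) ->
              (k%:E <= F b')%E) ->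
  ((k * (2 * rho) ^+ size js)%:E <= iterint js F b)%E.
Proof.
move=> + k0 rho0 F0; elim: js b => [|j js IH] b /=.
  by move=> _ Fk; rewrite expr0 mulr1; apply: Fk.
move=> /andP[jjs ujs] Fk.
have -> : k * (2 * rho) ^+ (size js).+1 =
    k * (2 * rho) ^+ size js * ((b0 j + rho) - (b0 j - rho)).
  by rewrite exprSr -mulrA; congr (_ * (_ * _)); ring.
apply: le_integral_itv_cst.
- by rewrite mulr_ge0// exprn_ge0// mulr_ge0.
- lra.
- by move=> x; exact: iterint_ge0.
move=> x xj; apply: IH => // b' b'E b'js; apply: Fk => i.
- rewrite inE negb_or => /andP[ij ijs].
  by rewrite b'E// /upd (negbTE ij).
- rewrite inE => /predU1P[->|/b'js//].
  by rewrite b'E// /upd eqxx; rewrite ler_distlC; lra.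
Qed.

Lemma Cn_ge0 d (a : R) : 0 <= Cn d a.
Proof. by rewrite invr_ge0 sumr_ge0// => i _; exact: powR_ge0. Qed.

Lemma prior_coef_ge0 d (a lam : R) (S : {set 'I_d}) :
  0 <= lam -> 0 <= prior_coef a lam S.
Proof.
move=> lam0; rewrite /prior_coef !mulr_ge0 ?Cn_ge0 ?invr_ge0//.
by rewrite exprn_ge0// divr_ge0// mulr_ge0// powR_ge0.
Qed.

Lemma le_prior_integral d (a lam k rho : R) (S : {set 'I_d}) (b0 : 'I_d -> R)
    (g : ('I_d -> R) -> R) :
  0 <= lam -> 0 <= k -> 0 <= rho -> (forall b, 0 <= g b) ->
  (forall b, (forall i, i \notin S -> b i = 0) ->
             (forall i, i \in S -> `|b i - b0 i| <= rho) ->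
             k <= g b * expR (- lam * l1 b)) ->
  ((prior_coef a lam S * (k * (2 * rho) ^+ #|S|))%:E
     <= prior_integral a lam g)%E.
Proof.
move=> lam0 k0 rho0 g0 gk.
have F0 b : (0 <= (g b * expR (- lam * l1 b))%:E)%E.
  by rewrite lee_fin mulr_ge0// expR_ge0.
rewrite /prior_integral (bigD1 S)//= EFinM.
apply: (@le_trans _ _ ((prior_coef a lam S)%:E *
    int_RS S (fun b => (g b * expR (- lam * l1 b))%:E))%E).
  apply: lee_wpmul2l; first by rewrite lee_fin prior_coef_ge0.
  rewrite [#|_|]cardE; apply: (@le_iterint _ _ _ b0) => //; first exact: enum_uniq.
  move=> b bS bS'; rewrite lee_fin; apply: gk => i iS.
    by apply: bS; rewrite mem_enum.
  by apply: bS'; rewrite mem_enum.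
apply: leeDl; apply: sume_ge0 => S' _.
by apply: mule_ge0; [rewrite lee_fin prior_coef_ge0|exact: iterint_ge0].
Qed.

Lemma bin_le_expn n m : ('C(n, m) <= n ^ m)%N.
Proof.
apply: (@leq_trans (n ^_ m)).
  by rewrite -bin_ffact leq_pmulr// fact_gt0.
elim: m => [//|m IH]; by rewrite ffactnSr expnSr leq_mul// leq_subr.
Qed.

(** The exponent [a + 6] per active coordinate splits as [a] from the prior weight, [5] from
    [lam * rho], and [1] from the binomial coefficient. *)
Lemma le_prior_coef d (a lam rho : R) (S : {set 'I_d}) : (0 < d)%N ->
  d%:R ^- 5 <= lam * rho ->
  Cn d a * d%:R `^ (- ((a + 6) * #|S|%:R))
    <= prior_coef a lam S * (2 * rho) ^+ #|S|.
Proof.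
move=> d0 lr; set s := #|S|; have d0' : 0 < d%:R :> R by rewrite ltr0n.
have da : 0 < d%:R `^ a :> R by rewrite powR_gt0.
rewrite /prior_coef -/s -!mulrA ler_wpM2l ?Cn_ge0// -exprMn.
have -> : lam / (2 * d%:R `^ a) * (2 * rho) = lam * rho * (d%:R `^ a)^-1.
  by field; rewrite lt0r_neq0.
have -> : (d%:R : R) `^ (- ((a + 6) * s%:R)) =
    (d%:R ^+ s)^-1 * (d%:R ^- 5 * (d%:R `^ a)^-1) ^+ s.
  rewrite powRN powRrM powR_mulrn ?powR_ge0// powRD; last by rewrite lt0r_neq0// implybT.
  rewrite -!exprVn -exprMn; congr (_ ^+ _).
  rewrite powR_mulrn ?ltW//.
  by field; rewrite !lt0r_neq0.
have sd : (s <= d)%N by rewrite -[leqRHS]card_ord; exact: max_card.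
apply: ler_pM.
- by rewrite invr_ge0 exprn_ge0// ltW.
- by rewrite exprn_ge0// mulr_ge0 ?invr_ge0 ?exprn_ge0 ?ltW.
- rewrite lef_pV2 ?posrE ?exprn_gt0 ?ltr0n ?bin_gt0//.
  by rewrite -natrX ler_nat bin_le_expn.
have d5 : 0 < d%:R ^- 5 :> R by rewrite invr_gt0 exprn_gt0.
have lr0 := le_trans (ltW d5) lr.
have dai0 : 0 <= (d%:R `^ a)^-1 by rewrite invr_ge0 ltW.
by rewrite lerXn2r ?nnegrE ?ler_wpM2r// mulr_ge0// ltW.
Qed.

Lemma l1_dist_le d (S : {set 'I_d}) (b b0 : 'I_d -> R) (rho : R) :
  (forall i, i \notin S -> b i = b0 i) ->
  (forall i, i \in S -> `|b i - b0 i| <= rho) ->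
  \sum_(i < d) `|b i - b0 i| <= #|S|%:R * rho.
Proof.
move=> bS bS'; rewrite (bigID (mem S))/= [X in _ + X]big1 ?addr0; last first.
  by move=> i /bS ->; rewrite subrr normr0.
apply: (le_trans (ler_sum _ bS')).
by rewrite sumr_const mulr_natl.
Qed.

Lemma le_Xnorm n d (X : 'M[R]_(n, d)) i j : `|X i j| <= Xnorm X.
Proof.
apply: le_trans (le_bigmax _ _ i); exact: (le_bigmax _ _ j).
Qed.

Lemma Xnorm_ge0 n d (X : 'M[R]_(n, d)) : 0 <= Xnorm X.
Proof. by apply: bigmax_ge_id. Qed.

Lemma lin_pred_dist_le n d (X : 'M[R]_(n, d)) (b b0 : 'I_d -> R) i :
  `|lin_pred X b i - lin_pred X b0 i| <= Xnorm X * \sum_(j < d) `|b j - b0 j|.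
Proof.
rewrite /lin_pred -sumrB mulr_sumr.
apply: (le_trans (ler_norm_sum _ _ _)); apply: ler_sum => j _.
by rewrite -mulrBr normrM ler_wpM2r// le_Xnorm.
Qed.

(** The triangle inequality bounds [Zn] and the quadratic remainder of [A] bounds [Dn]; all
    randomness is left in the sum of absolute deviations. *)
Lemma Ln_ge n d (A eta : R -> R) (Tobs ET : 'I_n -> R) (X : 'M[R]_(n, d))
    (b b0 : 'I_d -> R) (B e : R) : 0 <= B ->
  (forall i, `|eta (lin_pred X b i) - eta (lin_pred X b0 i)| <= e) ->
  (forall x y, `|A (eta y) - A (eta x) - (eta y - eta x) * derive1 A (eta x)|
               <= B * (eta y - eta x) ^+ 2) ->
  - ((\sum_(i < n) `|Tobs i - ET i|) * e) - n%:R * (B * e ^+ 2)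
    <= Ln A Tobs ET eta X b b0.
Proof.
move=> B0 be tA; rewrite /Ln lerB//.
- rewrite lerNl; apply: (le_trans (ler_norm _)); rewrite normrN.
  apply: (le_trans (ler_norm_sum _ _ _)); rewrite mulr_suml; apply: ler_sum => i _.
  by rewrite normrM ler_wpM2l.
- rewrite -[n in n%:R]card_ord mulr_natl -sumr_const; apply: ler_sum => i _.
  apply: (le_trans (ler_norm _)); apply: (le_trans (tA _ _)).
  by rewrite ler_wpM2l// -real_normK ?num_real// lerXn2r ?nnegrE// (le_trans _ (be i)).
Qed.

End Prior.

(** * The exponential family on the clipping interval *)

Section ClippedFamily.
Context {R : realType}.

Lemma lipschitz_continuous (f : R -> R) (K : R) :
  (forall x y, `|f x - f y| <= K * `|x - y|) -> continuous f.
Proof.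
move=> fK x; apply/cvgrPdist_lt => e e0.
(* No sign of [K] is assumed, so [|K| + 1] serves as a positive Lipschitz constant. *)
have k0 : 0 < `|K| + 1 by rewrite ltr_wpDl.
apply/nbhs_normP; exists (e / (`|K| + 1)); first by rewrite /= divr_gt0.
move=> y /=; rewrite ltr_pdivlMr// mulrC; apply: le_lt_trans.
apply: (le_trans (fK x y)); rewrite ler_wpM2r//.
by rewrite (le_trans (ler_norm K))// lerDl.
Qed.

Lemma continuous_inj_between (f : R -> R) (x : R) :
  continuous f -> injective f ->
  f (x - 1) < f x < f (x + 1) \/ f (x + 1) < f x < f (x - 1).
Proof.
move=> cf injf.
have cf' : {within [set` `]-oo, +oo[], continuous f}.
  by apply: continuous_subspaceT.
have x1 : x - 1 < x by rewrite ltrBlDr ltrDl.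
have x2 : x < x + 1 by rewrite ltrDl.
have [m|m] := itv_continuous_inj_mono cf' (in2W injf).
- by left; rewrite !m ?in_itv.
- by right; rewrite !m ?in_itv.
Qed.

Variables (mu : {measure set R -> \bar R}) (h T : R -> R) (Theta : set R).
Variables (A : R -> R) (M0 : R) (eta : R -> R).
Hypothesis h0 : forall y, 0 <= h y.
Hypothesis mh : measurable_fun setT h.
Hypothesis mT : measurable_fun setT T.
Hypothesis AE : forall th, Theta th ->
  (\int[mu]_y (h y * expR (th * T y))%:E)%E = (expR (A th))%:E.
Hypothesis dA : forall th, Theta th ->
  derivable A th 1 /\ derivable (derive1 A) th 1.
Hypothesis itvA : forall bb, 0 < bb -> is_interval (IA Theta A bb).
Hypothesis M0_gt0 : 0 < M0.
Hypothesis eta_inj : injective eta.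
Hypothesis eta_cont : continuous eta.
Hypothesis eta_clip : forall x, IA Theta A (M0 ^+ 2 / 2) (eta x).

Let itvI : is_interval (IA Theta A (M0 ^+ 2 / 2)).
Proof. by apply: itvA; rewrite divr_gt0 ?exprn_gt0. Qed.

Lemma clipped_bregman_le (u v : R) :
  IA Theta A (M0 ^+ 2 / 2) u -> IA Theta A (M0 ^+ 2 / 2) v ->
  `|A v - A u - (v - u) * derive1 A u| <= M0 ^+ 2 / 2 * (v - u) ^+ 2.
Proof.
apply: taylor1_le itvI _ => z [/dA[dz ddz] /andP[z0 zM]].
by split => //; rewrite ger0_norm.
Qed.

(** * Deviation of the sufficient statistic of one observation *)

Section Observation.
Context d (Om : measurableType d) (P : probability Om R) (Y : Om -> R) (x : R).
Hypothesis mY : measurable_fun setT Y.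
Hypothesis lawY : forall B, measurable B ->
  P (Y @^-1` B) =
  (\int[mu]_(y in B) (h y * expR (eta x * T y - A (eta x)))%:E)%E.

(** Exponential tilting: multiplying the density at [eta x] by [exp (s T)] gives, up to a constant,
    the density at [eta x + s], whose normalizer is [exp (A (eta x + s))]. *)
Lemma clipped_mgf (s m : R) : Theta (eta x + s) ->
  (\int[P]_w (expR (s * (T (Y w) - m)))%:E =
    (expR (A (eta x + s) - A (eta x) - s * m))%:E)%E.
Proof.
move=> Ths.
have mf : measurable_fun setT (fun y => h y * expR (eta x * T y - A (eta x))).
  apply: measurable_funM => //; apply: measurableT_comp => //.
  by apply: measurable_funB => //; exact: measurable_funM.
have mg : measurable_fun setT (fun y => expR (s * (T y - m))).
  apply: measurableT_comp => //; apply: measurable_funM => //.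
  exact: measurable_funB.
rewrite (@ge0_integral_density _ _ _ P mu Y _ _ mY mf mg)//; last first.
  by move=> y; rewrite mulr_ge0// expR_ge0.
have mk : measurable_fun setT (fun y => (h y * expR ((eta x + s) * T y))%:E).
  apply/measurable_EFinP; apply: measurable_funM => //.
  by apply: measurableT_comp => //; exact: measurable_funM.
transitivity (\int[mu]_y ((expR (- A (eta x) - s * m))%:E *
                          (h y * expR ((eta x + s) * T y))%:E))%E.
  apply: eq_integral => y _; rewrite -EFinM mulrCA -mulrA -!expRD.
  by congr (_ * expR _)%:E; ring.
rewrite ge0_integralZl//; last first.
  by move=> y _; rewrite lee_fin mulr_ge0// expR_ge0.
by rewrite AE// -EFinM -expRD; congr (expR _)%:E; ring.
Qed.

(* A two-sided neighbourhood of [eta x] lies in the clipping interval because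
   [eta] is continuous and injective, hence strictly monotone. *)
Lemma clipped_mean_dev_le :
  (\int[P]_w `|T (Y w) - fine 'E_P[T \o Y]|%:E
     <= (2 * (1 + 8 * M0 ^+ 2))%:E)%E.
Proof.
have [u [v [Iu Iv uxv]]] : exists u v, [/\ IA Theta A (M0 ^+ 2 / 2) u,
    IA Theta A (M0 ^+ 2 / 2) v & u < eta x < v].
  have [e|e] := continuous_inj_between eta x eta_cont eta_inj.
  - by exists (eta (x - 1)), (eta (x + 1)).
  - by exists (eta (x + 1)), (eta (x - 1)).
case/andP: uxv => ux xv.
(* The first two bounds keep [eta x + t] and [eta x - t] in the clipping interval; the third gives
   [(M0 t)^2 / 2 <= 1 / 2]. *)
pose t := Num.min (Num.min (eta x - u) (v - eta x)) M0^-1.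
have t0 : 0 < t by rewrite !lt_min !subr_gt0 ux xv invr_gt0.
have [tu tv tM] : [/\ t <= eta x - u, t <= v - eta x & t <= M0^-1].
  by rewrite /t !ge_min !lexx !orbT.
have It s : `|s| <= t -> IA Theta A (M0 ^+ 2 / 2) (eta x + s).
  rewrite ler_norml => /andP[s1 s2]; apply: (itvI _ _ Iu Iv); lra.
(* With centre [A' (eta x)], the logarithm of the exponential moment is exactly the first order
   Taylor remainder of [A]. *)
have mgf s : `|s| = t ->
    (\int[P]_w (expR (s * (T (Y w) - derive1 A (eta x))))%:E
       <= (expR (M0 ^+ 2 / 2 * t ^+ 2))%:E)%E.
  move=> st; have Is : IA Theta A (M0 ^+ 2 / 2) (eta x + s) by apply: It; rewrite st.
  rewrite clipped_mgf; last by case: Is.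
  rewrite lee_fin ler_expR -st real_normK ?num_real//.
  have := clipped_bregman_le _ _ (eta_clip x) Is.
  rewrite [eta x + s - eta x]addrAC subrr add0r.
  exact: le_trans (ler_norm _).
have mTY : measurable_fun setT (T \o Y) by exact: measurableT_comp.
rewrite mulr_natl mulr2n.
apply: (@mean_abs_dev_le _ _ _ _ (T \o Y) (derive1 A (eta x))) => //.
rewrite (_ : 8 * M0 ^+ 2 = 16 * (M0 ^+ 2 / 2)); last by field.
apply: (@subgaussian_dev_le _ _ _ _ (T \o Y) (derive1 A (eta x)) _ t) => //.
- by rewrite divr_ge0// sqr_ge0.
- rewrite mulrAC -exprMn ler_wpM2r// expr_le1//.
    by rewrite -ler_pdivlMl ?mulr1.
  by rewrite mulr_ge0 ?(ltW M0_gt0) ?(ltW t0).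
- by apply: mgf; rewrite gtr0_norm.
- by apply: mgf; rewrite normrN gtr0_norm.
Qed.

End Observation.
End ClippedFamily.

(** * Concentration of the deviations and the marginal likelihood bound *)

Section Marginal.
Context {R : realType}.

Lemma measurable_sum_ge d (Om : measurableType d) (n : nat)
    (V : 'I_n -> Om -> R) (t : R) : (forall i, measurable_fun setT (V i)) ->
  measurable [set w | t <= \sum_(i < n) V i w].
Proof.
move=> mV; set D := [set w | _].
have mS : measurable_fun setT (fun w => \sum_(i < n) V i w).
  exact: measurable_sum.
rewrite -[D]setTI; have -> : D = (fun w => \sum_(i < n) V i w) @^-1` `[t, +oo[.
  by apply/seteqP; split => w /=; rewrite in_itv/= andbT.
by apply: mS => //; exact: measurable_itv.
Qed.

Lemma sum_markov d (Om : measurableType d) (P : probability Om R) (n : nat)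
    (V : 'I_n -> Om -> R) (C t : R) :
  (forall i, measurable_fun setT (V i)) -> (forall i w, 0 <= V i w) ->
  (forall i, \int[P]_w (V i w)%:E <= C%:E)%E -> 0 < t ->
  (P [set w | (t <= \sum_(i < n) V i w)%R] <= (n%:R * C / t)%:E)%E.
Proof.
move=> mV V0 VC t0; set D := [set w | _].
have mD : measurable D by exact: measurable_sum_ge.
have : (t%:E * P D <= (n%:R * C)%:E)%E.
  apply: (@le_trans _ _ (\int[P]_w (\sum_(i < n) V i w)%:E)%E).
    by apply: le_integral_cst_on => //;
      [exact: ltW|move=> w; rewrite lee_fin sumr_ge0].
  under eq_integral do rewrite -sumEFin.
  rewrite ge0_integral_sum//; last 2 first.
  - by move=> i; exact/measurable_EFinP.
  - by move=> i w _; rewrite lee_fin.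
  apply: (le_trans (lee_sum _ (fun i _ => VC i))).
  by rewrite sumEFin lee_fin sumr_const card_ord mulr_natl.
by rewrite -lee_pdivlMl// -EFinM mulrC.
Qed.

Lemma supp_sizeE d (b : 'I_d -> R) : supp_size b = #|[set j | b j != 0]%SET|.
Proof.
apply: eq_card => j; rewrite [RHS]finset.inE.
by apply/idP/idP => [/set_mem//|bj]; apply: mem_set.
Qed.

(** For a zero design the likelihood ratio is identically [1], and the empty model alone contributes
    the mass [Cn d a]. *)
Lemma prior_integral_Xnorm0 n d (X : 'M[R]_(n, d)) (A eta : R -> R)
    (Tobs ET : 'I_n -> R) (b0 : 'I_d -> R) (a : R) : Xnorm X = 0 ->
  ((Cn d a)%:E <= prior_integral a 0 (fun b => expR (Ln A Tobs ET eta X b b0)))%E.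
Proof.
move=> X0.
have X00 i j : X i j = 0.
  by apply/eqP; rewrite -normr_le0 -X0 le_Xnorm.
have lp b i : lin_pred X b i = 0.
  by rewrite /lin_pred big1// => j _; rewrite X00 mul0r.
have L0 b : Ln A Tobs ET eta X b b0 = 0.
  by rewrite /Ln /Zn /Dn !big1 ?subrr// => i _; rewrite !lp !subrr ?mulr0// mul0r subrr.
have := @le_prior_integral R d a 0 1 0 finset.set0 b0
  (fun b => expR (Ln A Tobs ET eta X b b0)) (lexx _) ler01 (lexx _).
rewrite /prior_coef cards0 bin0 invr1 !expr0 !mulr1; apply.
- by move=> b; exact: expR_ge0.
- by move=> b _ _; rewrite L0 oppr0 mul0r expR0 mulr1.
Qed.

(* The prior is restricted to the cube of half-side [r / s] around the true
   parameter inside its support, with [r = 1 / (G * Xnorm X * n ^ 2)]: this is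
   so small that the log-likelihood ratio is bounded below on the whole cube. *)
Lemma marginal_ge n d (X : 'M[R]_(n, d)) (A eta : R -> R)
    (Tobs ET : 'I_n -> R) (b0 : 'I_d -> R) (K B C M G a lam : R) :
  0 <= a -> 0 <= K -> 0 <= B -> 1 <= M -> M <= G -> K * C <= G ->
  B * K ^+ 2 <= G ^+ 2 ->
  (0 < n)%N -> (n < d)%N -> G <= d%:R -> ln (d%:R : R) <= n%:R ->
  (forall x y, `|eta x - eta y| <= K * `|x - y|) ->
  (forall x y, `|A (eta y) - A (eta x) - (eta y - eta x) * derive1 A (eta x)|
               <= B * (eta y - eta x) ^+ 2) ->
  Xnorm X * M / d%:R <= lam <= Xnorm X * M * Num.sqrt (ln d%:R) ->
  (0 < supp_size b0)%N ->
  \sum_(i < n) `|Tobs i - ET i| <= C * n%:R ^+ 2 ->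
  ((expR (- 3 : R) * Cn d a * d%:R `^ (- ((a + 6) * (supp_size b0)%:R))
      * expR (- lam * l1 b0))%:E
    <= prior_integral a lam (fun b => expR (Ln A Tobs ET eta X b b0)))%E.
Proof.
move=> a0 K0 B0 M1 MG KG BG n0 nd Gd lnd lip tay /andP[lam1 lam2] s0 TC.
have d0 : (0 < d)%N by exact: leq_trans nd.
have G1 : 1 <= G := le_trans M1 MG.
have G0 : 0 < G := lt_le_trans ltr01 G1.
have n1 : 1 <= n%:R :> R by rewrite ler1n.
have dR : 0 < d%:R :> R by rewrite ltr0n.
have nR : 0 < n%:R :> R by rewrite ltr0n.
(* A zero design is treated apart: the bounds on [lam] then force [lam = 0], and the cube radius
   below would be an inverse of zero. *)
have [x0|x0] := eqVneq (Xnorm X) 0.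
  have lam0 : lam = 0.
    by apply/le_anti; move: lam1 lam2; rewrite x0 !mul0r => -> ->.
  rewrite lam0 oppr0 mul0r expR0 mulr1.
  apply: le_trans (prior_integral_Xnorm0 _ _ X A eta Tobs ET b0 a x0).
  rewrite lee_fin mulrAC -[leRHS]mul1r ler_wpM2r ?Cn_ge0//.
  rewrite -[leRHS]mulr1 ler_pM ?expR_ge0 ?powR_ge0//.
  rewrite -[leRHS](powRr0 d%:R) ler_powR ?ler1n// oppr_le0 mulr_ge0//; lra.
have {}x0 : 0 < Xnorm X by rewrite lt_def x0 Xnorm_ge0.
set x := Xnorm X in x0 lam1 lam2.
rewrite supp_sizeE; rewrite supp_sizeE in s0; set S := finset _ in s0 *.
set s := #|S| in s0 *.
have sR : 0 < s%:R :> R by rewrite ltr0n.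
have sd : (s <= d)%N by rewrite -[leqRHS]card_ord; exact: max_card.
pose r := (G * x * n%:R ^+ 2)^-1; pose rho := r / s%:R.
have r0 : 0 < r by rewrite invr_gt0 !mulr_gt0.
have rho0 : 0 < rho by rewrite divr_gt0.
have srho : s%:R * rho = r by rewrite mulrC divfK// lt0r_neq0.
have n20 : 0 < n%:R ^+ 2 :> R by rewrite exprn_gt0.
have xr : x * r = (G * n%:R ^+ 2)^-1.
  by rewrite /r; field; rewrite !lt0r_neq0.
have lam0 : 0 <= lam.
  by apply: le_trans lam1; rewrite divr_ge0// mulr_ge0 ?(ltW x0)//; lra.
(* The upper bound on [lam] enters here, through [M <= G] and [sqrt (ln d) <= n^2]. *)
have lamr : lam * r <= 1.
  apply: (le_trans (ler_wpM2r (ltW r0) lam2)).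
  have -> : x * M * Num.sqrt (ln d%:R) * r = x * r * (M * Num.sqrt (ln d%:R)).
    by ring.
  rewrite xr mulrC ler_pdivrMr ?mulr_gt0// mul1r ler_pM ?sqrtr_ge0//; first lra.
  rewrite -[leRHS]ger0_norm ?(ltW n20)// -sqrtr_sqr ler_wsqrtr//.
  by apply: le_trans lnd _; rewrite -exprM ler_eXnr.
(* The five powers of [d] pay for the factor [1 / d] in the lower bound on [lam], for [s <= d], for
   [G <= d], and for [n^2 <= d^2]. *)
have lamrho : d%:R ^- 5 <= lam * rho.
  have -> : lam * rho = lam * r / s%:R by rewrite mulrA.
  rewrite ler_pdivlMr//.
  apply: le_trans (ler_wpM2r (ltW r0) lam1).
  have -> : x * M / d%:R * r = x * r * (M / d%:R) by field; rewrite lt0r_neq0.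
  rewrite xr -[leRHS]mulrC -mulrA -invfM ler_pdivlMr ?mulr_gt0//.
  have -> : d%:R ^- 5 * s%:R * (d%:R * (G * n%:R ^+ 2)) =
      (G / d%:R) * (n%:R / d%:R) ^+ 2 * (s%:R / d%:R).
    by field; rewrite lt0r_neq0.
  apply: le_trans M1; apply: mulr_ile1; last first.
  - by rewrite ler_pdivrMr// mul1r ler_nat.
  - apply: mulr_ile1; first 1 last.
    + by rewrite exprn_ge0// divr_ge0.
    + by rewrite ler_pdivrMr// mul1r.
    + by rewrite exprn_ile1 ?divr_ge0// ler_pdivrMr// mul1r ler_nat ltnW.
    + by rewrite divr_ge0 ?(ltW G0).
  - by rewrite divr_ge0.
  - by rewrite !mulr_ge0 ?invr_ge0 ?(ltW G0).
(* Of the exponent [3], one unit each pays for the stochastic term, the divergence term, and the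
   growth [lam * r] of the l1 penalty over the cube. *)
pose k := expR (- 3 : R) * expR (- lam * l1 b0).
have k0 : 0 <= k by rewrite mulr_ge0// expR_ge0.
apply: le_trans (@le_prior_integral R d a lam k rho S b0 _ lam0 k0 (ltW rho0) _ _).
- rewrite lee_fin.
  rewrite (_ : expR _ * _ * _ * _ =
    Cn d a * d%:R `^ (- ((a + 6) * s%:R)) * k); last by rewrite /k; ring.
  by rewrite [leRHS]mulrCA mulrC ler_wpM2l// le_prior_coef.
- by move=> b; exact: expR_ge0.
move=> b bS bS'.
have bS0 i : i \notin S -> b i = b0 i.
  move=> iS; rewrite bS//; move: iS; rewrite finset.inE negbK => /eqP ->//.
have bb0 := l1_dist_le d S b b0 rho bS0 bS'; rewrite -/s srho in bb0.
have l1b : l1 b <= l1 b0 + r.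
  apply: le_trans (lerD (lexx _) bb0); rewrite /l1 -big_split/=.
  apply: ler_sum => i _; rewrite -lerBlDl; apply: le_trans (lerB_dist _ _).
  exact: lexx.
pose e := K / (G * n%:R ^+ 2).
have eta_e i : `|eta (lin_pred X b i) - eta (lin_pred X b0 i)| <= e.
  apply: (le_trans (lip _ _)); rewrite ler_wpM2l// -xr.
  apply: (le_trans (lin_pred_dist_le _ _ _ _ _ _)).
  by rewrite ler_wpM2l// ltW.
have := @Ln_ge R n d A eta Tobs ET X b b0 B e B0 eta_e tay.
set L := Ln _ _ _ _ _ _ _ => Lge.
have Te : (\sum_(i < n) `|Tobs i - ET i|) * e <= 1.
  have e0 : 0 <= e by rewrite divr_ge0// mulr_ge0 ?(ltW G0) ?(ltW n20).
  apply: (le_trans (ler_wpM2r e0 TC)).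
  have -> : C * n%:R ^+ 2 * e = K * C / G.
    by rewrite /e; field; rewrite !lt0r_neq0.
  by rewrite ler_pdivrMr// mul1r.
have Be : n%:R * (B * e ^+ 2) <= 1.
  have -> : n%:R * (B * e ^+ 2) = (B * K ^+ 2 / G ^+ 2) * (n%:R ^+ 3)^-1.
    by rewrite /e; field; rewrite !lt0r_neq0.
  rewrite mulr_ile1 ?invr_ge0 ?exprn_ge0 ?invf_le1 ?exprn_gt0 ?exprn_ege1//.
  - by rewrite divr_ge0 ?sqr_ge0// mulr_ge0 ?sqr_ge0.
  - by rewrite ler_pdivrMr ?mul1r// exprn_gt0.
rewrite /k -!expRD ler_expR.
have := ler_wpM2l lam0 l1b; lra.
Qed.

End Marginal.

(** * The lower bound with high probability *)

Theorem theorem1 (R : realType) :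
  exists c : R, 0 < c /\
  forall (mu : {measure set R -> \bar R}) (h T : R -> R) (Theta : set R)
    (A : R -> R) (M0 : R) (eta : R -> R)
    (d : nat -> nat) (X : forall n : nat, 'M[R]_(n, d n))
    (a lam b : nat -> R) (beta_star : forall n : nat, 'I_(d n) -> R),
  (* exponential family h(y) exp(theta T(y) - A(theta)) w.r.t. base measure mu *)
  (forall y, 0 <= h y) -> measurable_fun setT h -> measurable_fun setT T ->
  Theta = [set th | (\int[mu]_y (h y * expR (th * T y))%:E < +oo)%E] ->
  (forall th, Theta th ->
     (\int[mu]_y (h y * expR (th * T y))%:E)%E = (expR (A th))%:E) ->
  (forall x y t, Theta x -> Theta y -> 0 <= t <= 1 ->
     A (t * x + (1 - t) * y) <= t * A x + (1 - t) * A y) ->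
  (forall th, Theta th -> derivable A th 1 /\ derivable (derive1 A) th 1) ->
  (forall bb, 0 < bb -> is_interval (IA Theta A bb)) ->
  is_interval (IA_inf Theta A) ->
  (* clipping function *)
  0 < M0 -> injective eta ->
  (exists K : R, forall x y, `|eta x - eta y| <= K * `|x - y|) ->
  (forall x, IA Theta A (M0 ^+ 2 / 2) (eta x)) ->
  (* asymptotic regime and hyperparameters *)
  (forall n, (n < d n)%N) ->
  (forall n, 0 < a n) ->
  (forall n, MAX M0 (X n) / (d n)%:R <= lam n
             <= MAX M0 (X n) * Num.sqrt (ln (d n)%:R)) ->
  (forall n, 0 < b n) ->
  (fun n => b n / (n%:R / ln (d n)%:R)) @ \oo --> (0 : R) ->
  (* beta^* in B_{2,n} *)
  (forall n, (0 < supp_size (beta_star n))%N /\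
             (supp_size (beta_star n))%:R <= b n) ->
  exists N : nat, forall n : nat, (N <= n)%N ->
    b n * ln (d n)%:R < n%:R ->
    forall (dO : measure_display) (Om : measurableType dO)
      (P : probability Om R) (Y : 'I_n -> Om -> R),
    (forall i, measurable_fun setT (Y i)) ->
    mutually_indep P Y ->
    (forall i B, measurable B ->
       P (Y i @^-1` B) =
       (\int[mu]_(y in B)
          (h y * expR (eta (lin_pred (X n) (beta_star n) i) * T y
                       - A (eta (lin_pred (X n) (beta_star n) i))))%:E)%E) ->
    let s := supp_size (beta_star n) in
    exists F : set Om, measurable F /\
      F `<=` [set w |
        ((c * Cn (d n) (a n) * (d n)%:R `^ (- ((a n + 6) * s%:R))
            * expR (- lam n * l1 (beta_star n)))%:E
         <= prior_integral (a n) (lam n)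
              (fun beta => expR (Ln A (fun i => T (Y i w))
                                     (fun i => fine ('E_P[T \o Y i]))
                                     eta (X n) beta (beta_star n))))%E] /\
      ((1 - (s%:R * ln (d n)%:R)^-1)%:E <= P F)%E.
Proof.
exists (expR (- 3)); split; first exact: expR_gt0.
move=> mu h T Theta A M0 eta d X a lam b bs h0 mh mT _ AE _ dA itvA _ M0_gt0
  eta_inj [K etaK] eta_clip nd a0 lamb b0 _ bsb.
have K0 : 0 <= K.
  by have := le_trans (normr_ge0 _) (etaK 1 0); rewrite subr0 normr1 mulr1.
have eta_cont := lipschitz_continuous eta K etaK.
pose B := M0 ^+ 2 / 2; pose C := 2 * (1 + 8 * M0 ^+ 2).
have B0 : 0 <= B by rewrite divr_ge0 ?sqr_ge0.
have C0 : 0 < C by have := sqr_ge0 M0; rewrite /C; lra.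
have M1_ge1 : 1 <= M1 M0.
  have m0 : 0 < Num.min 1 M0^-1 by rewrite lt_min ltr01 invr_gt0.
  by rewrite /M1 invf_ge1 ?ge_min ?lexx.
(* The three summands dominate, in turn, the factor in [lam], the stochastic term, and the
   divergence term, as [B * K^2 <= (M0 * K)^2]. None depends on [n]. *)
pose G := M1 M0 + K * C + M0 * K.
have KC0 : 0 <= K * C by rewrite mulr_ge0 ?(ltW C0).
have M0K : 0 <= M0 * K by rewrite mulr_ge0 ?(ltW M0_gt0).
(* This threshold ensures [G < n < d n], and also [n >= 2], which makes [ln (d n)] positive. *)
exists (Num.trunc G).+2 => n Nn bn dO Om P Y mY _ lawY s.
have [s0 sb] := bsb n; rewrite -/s in s0 sb.
have n2 : (2 <= n)%N by exact: leq_trans Nn.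
have ld0 : 0 < ln (d n)%:R :> R by rewrite ln_gt0// ltr1n (ltn_trans n2).
have s1 : 1 <= s%:R :> R by rewrite ler1n.
have sln : s%:R * ln (d n)%:R < n%:R :> R.
  by apply: le_lt_trans bn; rewrite ler_wpM2r// ltW.
have lnn : ln ((d n)%:R : R) <= n%:R.
  by apply: le_trans (ltW sln); rewrite ler_peMl// ltW.
have n0 : 0 < n%:R :> R by rewrite ltr0n; exact: leq_trans n2.
pose ET i := fine 'E_P[T \o Y i].
pose V i w := `|T (Y i w) - ET i|.
have mTY i : measurable_fun setT (T \o Y i) by exact: measurableT_comp.
have mV i : measurable_fun setT (V i).
  by apply: measurableT_comp => //; exact: measurable_funB (mTY i) _.
have VC i : (\int[P]_w (V i w)%:E <= C%:E)%E.
  exact: (clipped_mean_dev_le _ _ _ _ _ _ _ h0 mh mT AE dA itvA M0_gt0 eta_inj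
    eta_cont eta_clip _ _ _ _ _ (mY i) (lawY i)).
(* The level is tuned so that the Markov bound [n C / t] equals the allowed failure probability;
   [s ln d < n] keeps it below [C n^2]. *)
pose t := n%:R * C * (s%:R * ln (d n)%:R).
have sld0 : 0 < s%:R * ln (d n)%:R :> R by rewrite mulr_gt0// ltr0n.
have nC0 : 0 < n%:R * C := mulr_gt0 n0 C0.
have t0 : 0 < t := mulr_gt0 nC0 sld0.
pose D := [set w | t <= \sum_(i < n) V i w].
have mD : measurable D by exact: measurable_sum_ge.
(* The good event is that the total absolute deviation stays below [t]; on it the bound holds
   deterministically. *)
exists (~` D); split; [exact: measurableC|split].
- move=> w /negP; rewrite -ltNge => Vt /=.
  apply: (@marginal_ge _ _ _ _ _ _ _ _ _ K B C (M1 M0) G) => //.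
  + exact: ltW.
  + by rewrite /G; lra.
  + by rewrite /G; lra.
  + apply: (@le_trans _ _ ((M0 * K) ^+ 2)).
      rewrite exprMn ler_wpM2r ?sqr_ge0// /B; have := sqr_ge0 M0; lra.
    by rewrite lerXn2r ?nnegrE// /G; lra.
  + exact: leq_trans n2.
  + have GN : G < n%:R.
      apply: (lt_le_trans (truncnS_gt G)); rewrite ler_nat; exact: ltnW.
    by rewrite ltW// (lt_trans GN)// ltr_nat.
  + move=> x y.
    exact: (clipped_bregman_le _ _ _ dA itvA M0_gt0 _ _ (eta_clip x) (eta_clip y)).
  + exact: lamb.
  + apply: (le_trans (ltW Vt)); rewrite /t mulrAC mulrC ler_wpM2l ?(ltW C0)//.
    by rewrite expr2 (ler_pM2l n0) ltW.
- rewrite probability_setC// EFinB leeB//.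
  have := sum_markov _ _ P n V C t mV (fun i w => normr_ge0 _) VC t0.
  rewrite -/D; suff -> : n%:R * C / t = (s%:R * ln (d n)%:R)^-1 by [].
  by rewrite /t invfM mulrA mulfV ?mul1r// lt0r_neq0.
Qed.
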